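(* Let $z,q\in\mathbb C$ with $|q|<\frac{1}{1+|z|}$. The generating function $M^{**}(z;q)$ for the set $\mathcal M^{**}$ of strongly multimodal sequences is given by $$M^{**}(z;q)=\sum_{k\geq 1}\sum_{n\geq 1}\frac{z^k q^{kn}(-zq;q)_{n-1}^2}{\{zq;q\}_{n-1}^{k-1}}=\sum_{\mu\in\mathcal{M}^{**}}z^{\ell(\mu)}q^{|\mu|}.$$ The generating function $M^{*}(z;q)$ for the set $\mathcal M^{*}$ of semi-strongly multimodal sequences is given by $$M^{*}(z;q)=\sum_{k\geq 1}\sum_{n\geq 1}\frac{z^k q^{kn}(-zq;q)_{n-1}}{\{zq;q\}_{n-1}^{k-1}\,(zq;q)_{n-1}}=\sum_{\mu\in\mathcal{M}^{*}}z^{\ell(\mu)}q^{|\mu|}.$$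
   Context: Notation: $(z;q)_n:=\prod_{i=0}^{n-1}(1-zq^i)$ (with $(z;q)_0=1$), and $\{z;q\}_0:=1$, $\{z;q\}_n:=1-z\sum_{i=0}^{n-1}q^i$ for $n\ge1$. So $\{zq;q\}_n=1-z\sum_{i=1}^{n}q^i$. A multimodal sequence with $k$-fold peak ($k\ge 1$) is a finite nonempty sequence of positive integers whose maximum value $n$ (the peak value) occurs exactly $k$ times, such that the (possibly empty) part before the first occurrence of $n$ (the left-hand partition) is weakly increasing, and the (possibly empty) part after the last occurrence of $n$ (the right-hand partition) is weakly decreasing. All entries other than the $k$ peaks are $<n$. The $k-1$ subsequences between consecutive occurrences of $n$ are arbitrary, possibly empty, finite sequences of positive integers $<n$. $\mathcal M$ is the set of all multimodal sequences (all $k\ge1$). $\mathcal M^{**}$ (strongly multimodal sequences) is the set of $\mu\in\mathcal M$ whose left-hand partition is strictly increasing and whose right-hand partition is strictly decreasing. $\mathcal M^{*}$ (semi-strongly multimodal sequences) is the set of $\mu\in\mathcal M$ whose left-hand partition is strictly increasing, with no extra restriction on the right-hand partition. For a sequence $\mu$, $\ell(\mu)$ is its length (number of terms) and $|\mu|$ is its size (sum of terms). *)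

(* Defs.v *)
From HB Require Import structures.
From mathcomp Require Import all_boot all_order all_algebra finmap.
From mathcomp Require Import all_classical all_reals all_analysis.
From mathcomp Require Import complex.
From mathcomp.analysis.showcase Require summability.
Set Implicit Arguments.
Unset Strict Implicit.
Unset Printing Implicit Defensive.
Import Order.TTheory GRing.Theory Num.Theory numFieldNormedType.Exports.
Local Open Scope classical_set_scope.
Local Open Scope ring_scope.

Section Multimodal.

Definition peak (mu : seq nat) : nat := (\max_(i <- mu) i)%N.

Definition left_part (mu : seq nat) : seq nat := take (index (peak mu) mu) mu.

(* Computed on the reversal of mu, so that it starts after the last peak. *)
Definition right_part (mu : seq nat) : seq nat := rev (left_part (rev mu)).

Definition kfold_multimodal (k : nat) (mu : seq nat) : bool :=
  [&& mu != [::], all (fun i => 0 < i)%N mu, count_mem (peak mu) mu == k,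
      sorted leq (left_part mu) & sorted geq (right_part mu)].

Definition multimodal : set (seq nat) :=
  [set mu | exists2 k, (1 <= k)%N & kfold_multimodal k mu].

Definition strongly_multimodal : set (seq nat) :=
  [set mu | [/\ multimodal mu, sorted ltn (left_part mu)
              & sorted gtn (right_part mu)]].

Definition semistrongly_multimodal : set (seq nat) :=
  [set mu | multimodal mu /\ sorted ltn (left_part mu)].

End Multimodal.

Section QSeries.
(* Instantiated with C := R[i] for R : realType. *)
Variable C : numFieldType.
Implicit Types (z q s : C) (n k : nat).

Definition qpoch z q n : C := \prod_(0 <= i < n) (1 - z * q ^+ i).

(* qpoch is (z;q)_n and qbrace is {z;q}_n; the sum in the latter is
   empty for n = 0, which gives {z;q}_0 = 1. *)
Definition qbrace z q n : C := 1 - z * \sum_(0 <= i < n) q ^+ i.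

Definition weight z q (mu : seq nat) : C := z ^+ size mu * q ^+ sumn mu.

(* Unconditional convergence: limit of the finite subsums over A along the
   directed set of finite sets of indices. *)
Definition has_sum (I : choiceType) (A : set I) (f : I -> C) s : Prop :=
  summability.partial_sum (f \_ A) @ summability.totally --> s.

(* The value is meaningful only when the family converges unconditionally. *)
Definition genfun (A : set (seq nat)) z q : C :=
  summability.sum (weight z q \_ A : seq nat -> C^o).

(* sum_{k >= 1} sum_{n >= 1} a k n = s, every series being convergent. *)
Definition has_iterated_sum (a : nat -> nat -> C) s : Prop :=
  exists2 b : nat -> C,
    forall k, (1 <= k)%N -> (\sum_(1 <= n < N) a k n) @[N --> \oo] --> b k
  & (\sum_(1 <= k < N) b k) @[N --> \oo] --> s.

End QSeries.

(* Main.v *)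
Require Import Defs.
From mathcomp Require Import all_boot all_order all_algebra finmap.
From mathcomp Require Import all_classical all_reals all_analysis.
From mathcomp Require Import complex ring.
From mathcomp.analysis.showcase Require summability.
Import Order.TTheory GRing.Theory Num.Theory numFieldNormedType.Exports.
Local Open Scope classical_set_scope.
Local Open Scope ring_scope.

(* A sequence with [k] peaks of value [n] factors uniquely as
   L, n, S_1, n, ..., S_{k-1}, n, R with all entries of L, S_i, R below n, and
   the weight z^l q^|.| is multiplicative under concatenation.  The set S of
   all sequences with entries below n satisfies
   S = {[::]} + {1, ..., n-1} S, so it has weight 1 / {zq;q}_{n-1}; the
   q-products of L and R come from recording whether, or how often, the value
   n - 1 is used.  All rearrangements are licensed by absolute convergence over
   all sequences of positive integers, whose total weight in absolute value is
   the geometric series of ratio |z| |q| / (1 - |q|) < 1. *)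

#[local] Existing Instance summability.totally_filter.

(** * Unconditional sums over arbitrary index sets *)

Section HasSum.
Context {C : numFieldType}.
Implicit Types (s t c : C).

Lemma partial_sumE {I : choiceType} (f : I -> C) (F : {fset I}) :
  summability.partial_sum f F = \sum_(x <- F) f x.
Proof. by rewrite big_seq_fsetE. Qed.

Lemma has_sumP {I : choiceType} (A : set I) (f : I -> C) s :
  has_sum A f s <->
  forall e, 0 < e -> exists F0 : {fset I}, forall F : {fset I},
    (F0 `<=` F)%fset -> `|s - \sum_(x <- F) (f \_ A) x| < e.
Proof.
split=> [/cvgrPdist_lt h e /h|h].
  by case=> F0 _ hF0; exists F0 => F /hF0 /=; rewrite partial_sumE.
apply/cvgrPdist_lt => e /h[F0 hF0]; exists F0 => // F /hF0 /=.
by rewrite partial_sumE.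
Qed.

Lemma has_sumTP {I : choiceType} (f : I -> C) s :
  has_sum setT f s <->
  forall e, 0 < e -> exists F0 : {fset I}, forall F : {fset I},
    (F0 `<=` F)%fset -> `|s - \sum_(x <- F) f x| < e.
Proof. by rewrite has_sumP patch_setT. Qed.

Lemma eq_has_sum {I : choiceType} {A B : set I} {f g : I -> C} {s} :
  f \_ A =1 g \_ B -> has_sum A f s -> has_sum B g s.
Proof. by move=> /funext; rewrite /has_sum => ->. Qed.

Lemma has_sum_unique {I : choiceType} {A : set I} {f : I -> C} {s t} :
  has_sum A f s -> has_sum A f t -> s = t.
Proof. by move=> hs ht; apply: (cvg_unique _ hs ht); exact: norm_hausdorff. Qed.

Lemma has_sumD {I : choiceType} {A : set I} {f g : I -> C} {s t} :
  has_sum A f s -> has_sum A g t -> has_sum A (f \+ g) (s + t).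
Proof.
move=> hs ht; rewrite /has_sum.
under eq_cvg => F.
  rewrite partial_sumE; under eq_bigr => x _.
    rewrite (_ : _ x = (f \_ A) x + (g \_ A) x); last first.
      by rewrite !patchE; case: ifP => //; rewrite addr0.
    over.
  rewrite big_split /= -!partial_sumE; over.
exact: cvgD.
Qed.

Lemma has_sumZ {I : choiceType} {A : set I} {f : I -> C} {s} c :
  has_sum A f s -> has_sum A (fun x => c * f x) (c * s).
Proof.
move=> hs; rewrite /has_sum.
under eq_cvg => F.
  rewrite partial_sumE; under eq_bigr => x _.
    rewrite (_ : _ x = c * (f \_ A) x); last first.
      by rewrite !patchE; case: ifP => //; rewrite mulr0.
    over.
  rewrite -mulr_sumr -partial_sumE; over.
exact: cvgMr.
Qed.

Lemma has_sumU {I : choiceType} {A B : set I} {f : I -> C} {s t} :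
  A `&` B `<=` set0 -> has_sum A f s -> has_sum B f t ->
  has_sum (A `|` B) f (s + t).
Proof.
move=> dAB hs ht.
apply: (@eq_has_sum _ setT _ (f \_ A \+ f \_ B)); last first.
  by apply: has_sumD; [move: hs|move: ht];
    apply: eq_has_sum => x; rewrite [RHS]patchE in_setT.
move=> x; rewrite [LHS]patchE in_setT /= !patchE in_setU.
have [xA|_] := boolP (x \in A); have [xB|_] := boolP (x \in B);
  rewrite ?addr0 ?add0r //.
by case: (dAB x); split; apply: set_mem.
Qed.

Lemma has_sum_finite {I : choiceType} (F : {fset I}) (f : I -> C) :
  has_sum [set` F] f (\sum_(x <- F) f x).
Proof.
apply/has_sumP => e e0; exists F => G FG.
rewrite [X in _ - X](big_fsetID _ (mem F)) /= [X in _ - (_ + X)]big1_fset ?addr0; last first.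
  move=> x; rewrite !inE => /andP[_ /negP xF] _; rewrite patchE.
  by case: ifP => // /set_mem.
have -> : [fset x in G | x \in F]%fset = F.
  apply/fsetP => x; rewrite !inE andbC; case: (boolP (x \in F)) => //=.
  exact: (fsubsetP FG).
rewrite [X in _ - X](eq_big_seq f) ?subrr ?normr0 // => x xF.
by rewrite patchE mem_set.
Qed.

Lemma has_sum_set0 {I : choiceType} (f : I -> C) : has_sum set0 f 0.
Proof.
move: (has_sum_finite fset0 f); rewrite big_seq_fset0.
by apply: eq_has_sum => x; rewrite !patchE !memNset.
Qed.

Lemma has_sum_set1 {I : choiceType} (i : I) (f : I -> C) :
  has_sum [set i] f (f i).
Proof.
move: (has_sum_finite [fset i]%fset f); rewrite big_seq_fset1.
by apply: eq_has_sum => x; congr patch; apply/seteqP; split => y /=;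
  rewrite inE => /eqP.
Qed.

(** Summation by blocks. A single finite set [F] is taken large enough to control both the total [s]
    and the finitely many fibre sums over [G], which reduces the claim to a finite double sum. *)
Lemma has_sum_fibres {I J : choiceType} (A : set I) (p : I -> J) (f : I -> C)
    s (b : J -> C) :
  has_sum A f s -> (forall j, has_sum (A `&` p @^-1` [set j]) f (b j)) ->
  has_sum setT b s.
Proof.
move=> /has_sumP hs hb; apply/has_sumTP => e e0.
have e20 : 0 < e / 2 by rewrite divr_gt0.
have [F0 hF0] := hs _ e20.
(* Once [G] contains the image of [F0], discarding the points of [F] whose image lies outside [G]
   keeps all of [F0], so the estimate for [s] still applies. *)
exists [fset p x | x in F0]%fset => G F0G.
have hG : (\sum_(j <- G) summability.partial_sum
             (f \_ (A `&` p @^-1` [set j])) F)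
     @[F --> summability.totally] --> \sum_(j <- G) b j.
  by apply: cvg_big => [|j _]; [exact: add_continuous|exact: hb].
move/cvgrPdist_lt : hG => /(_ _ e20)[F1 _ hF1].
have := hF1 (F0 `|` F1)%fset (fsubsetUr _ _).
set F := (F0 `|` F1)%fset => /= hF.
have hF' : `|s - \sum_(x <- [fset x in F | p x \in G]%fset) (f \_ A) x|
    < e / 2.
  apply: hF0; apply/fsubsetP => x xF0; rewrite !inE xF0 /=.
  by apply: (fsubsetP F0G); apply: in_imfset.
have E : \sum_(j <- G) summability.partial_sum (f \_ (A `&` p @^-1` [set j])) F
       = \sum_(x <- [fset x in F | p x \in G]%fset) (f \_ A) x.
  under eq_bigr do rewrite partial_sumE.
  rewrite exchange_big /= big_fset /= [RHS]big_mkcond; apply: eq_bigr => x _.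
  case: ifPn => xG.
    rewrite (big_fsetD1 (p x)) //= big1_fset ?addr0 => [|j]; last first.
      rewrite !inE => /andP[/eqP jx _] _; rewrite patchE memNset //.
      by case=> _ /= /esym.
    by rewrite !patchE in_setI (mem_set (_ : (_ @^-1` _) x)) // andbT.
  rewrite big1_fset // => j jG _; rewrite patchE memNset //= => -[_ /= xj].
  by rewrite xj jG in xG.
rewrite E in hF; rewrite [e]splitr.
rewrite -(subrKA (\sum_(x <- [fset x in F | p x \in G]%fset) (f \_ A) x)).
by rewrite (le_lt_trans (ler_normD _ _))// ltrD // distrC.
Qed.

(** The fibres of [h] on [A] are singletons or empty, so this is a case of summation by fibres. *)
Lemma has_sum_image {I J : choiceType} {A : set I} {h : I -> J} {f : J -> C} {s} :
  {in A &, injective h} -> has_sum A (f \o h) s -> has_sum (h @` A) f s.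
Proof.
move=> hinj hs.
apply: (@eq_has_sum _ setT _ (f \_ (h @` A))).
  by move=> y; rewrite patch_setT.
apply: (@has_sum_fibres _ _ A h (f \o h)) hs _ => j; rewrite patchE.
case: ifPn => [/set_mem[x Ax <-]|jA].
  move: (has_sum_set1 x (f \o h)); apply: eq_has_sum => y.
  congr patch; apply/seteqP; split => z /=; first by move->.
  by case=> Az /hinj; apply; exact: mem_set.
move: (has_sum_set0 (f \o h)); apply: eq_has_sum => x.
rewrite !patchE !memNset // => -[Ax hx]; move/negP: jA; apply; apply: mem_set.
by exists x.
Qed.

Lemma has_sum_nat {f : nat -> C} {s} :
  has_sum setT f s -> (\sum_(0 <= k < N) f k) @[N --> \oo] --> s.
Proof.
move=> /has_sumTP hs; apply/cvgrPdist_lt => e /hs[F0 hF0].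
(* The successor is there because the range [0 <= k < N] excludes [N] but must contain the largest
   element of [F0]. *)
exists (\max_(i <- F0) i).+1 => // N /= hN.
have := hF0 [fset i in iota 0 N]%fset.
rewrite (perm_big (index_iota 0 N)); last first.
  apply: uniq_perm; rewrite ?fset_uniq ?iota_uniq // => i.
  by rewrite !inE /index_iota subn0.
apply.
apply/fsubsetP => i iF0; rewrite !inE mem_iota /= add0n.
by apply: leq_trans hN; rewrite ltnS; apply: leq_bigmax_seq.
Qed.

End HasSum.

(** * Existence of sums from bounds on finite absolute subsums *)

Section Existence.

Lemma ler_sum_uniq_sub {C : numDomainType} {I : eqType} (f : I -> C)
    (s s' : seq I) :
  (forall x, 0 <= f x) -> uniq s -> {subset s <= s'} ->
  \sum_(x <- s) f x <= \sum_(x <- s') f x.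
Proof.
move=> f0; elim: s s' => [|x s IH] s' /=; first by rewrite big_nil sumr_ge0.
case/andP => xs us sub; rewrite (perm_big _ (perm_to_rem (sub x _))) ?mem_head //.
rewrite !big_cons lerD2l; apply: IH => // y ys.
have /sub : y \in x :: s by rewrite inE ys orbT.
have /perm_mem -> : perm_eq s' (x :: rem x s') by apply/perm_to_rem/sub/mem_head.
by rewrite inE => /orP[/eqP yx|//]; rewrite -yx ys in xs.
Qed.

Variable R : realType.

(** Finite subsums grow with the finite set, so they converge to their supremum. *)
Lemma nonneg_has_sum {I : choiceType} (f : I -> R) B :
  (forall x, 0 <= f x) -> (forall F : {fset I}, \sum_(x <- F) f x <= B) ->
  exists s, has_sum setT f s.
Proof.
move=> f0 fB; pose S := [set \sum_(x <- F : {fset I}) f x | F in [set: {fset I}]].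
have hS : has_sup S.
  split; first by exists (\sum_(x <- fset0) f x); exists fset0.
  by exists B => _ [F _ <-].
exists (sup S); apply/has_sumTP => e e0.
have [_ [F0 _ <-] hF0] := sup_adherent e0 hS; exists F0 => F F0F.
have h1 : \sum_(x <- F0) f x <= \sum_(x <- F) f x.
  by apply: ler_sum_uniq_sub => //; exact/fsubsetP.
have h2 : \sum_(x <- F) f x <= sup S.
  by apply: ub_le_sup; [case: hS|exists F].
by rewrite ger0_norm ?subr_ge0 // ltrBlDl -ltrBlDr (lt_le_trans hF0).
Qed.

(** [f] is the difference of the nonnegative functions [|f| + f] and [|f|], whose finite subsums are
    bounded by [B + B] and [B]. *)
Lemma real_has_sum {I : choiceType} (f : I -> R) B :
  (forall F : {fset I}, \sum_(x <- F) `|f x| <= B) ->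
  exists s, has_sum setT f s.
Proof.
move=> fB.
have [|F|s hs] := @nonneg_has_sum _ (fun x => (`|f x| + f x)) (B + B).
- by move=> x; rewrite -lerBlDl sub0r lerNnormlW.
- rewrite big_split lerD // (le_trans _ (fB F)) // ler_sum // => x _.
  exact: ler_norm.
have [|F|t ht] := @nonneg_has_sum _ (fun x => `|f x|) B => //.
exists (s + -1 * t); have := has_sumD hs (has_sumZ (-1) ht).
by apply: eq_has_sum => x; rewrite !patch_setT /= mulN1r addrAC subrr add0r.
Qed.

Local Open Scope complex_scope.

Lemma has_sum_real_complex {I : choiceType} {f : I -> R} {s} :
  has_sum setT f s -> has_sum setT (fun x => (f x)%:C) s%:C.
Proof.
move=> /has_sumTP hs; apply/has_sumTP => -[e e'].
(* In the order of [R[i]], [0 < e] forces the imaginary part of [e] to vanish, so its real part can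
   be handed to the real statement. *)
rewrite ltcE /= => /andP[/eqP -> /hs[F0 hF0]]; exists F0 => F /hF0.
rewrite -rmorph_sum -rmorphB normc_def /= expr0n addr0 sqrtr_sqr.
by rewrite ltcE /= eqxx.
Qed.

Lemma normc_ge_Im (x : R[i]) : `|complex.Im x|%:C <= `|x|.
Proof.
by case: x => a b; simpc; rewrite -sqrtr_sqr ler_wsqrtr // lerDr sqr_ge0.
Qed.

Lemma complex_has_sum {I : choiceType} (f : I -> R[i]) B :
  (forall F : {fset I}, \sum_(x <- F) `|f x| <= B) ->
  exists s, has_sum setT f s.
Proof.
move=> fB.
(* An inequality in [R[i]] includes the inequality of real parts, so the complex bound [B] yields a
   real one. *)
have bound (g : I -> R) : (forall x, `|g x|%:C <= `|f x|) ->
    forall F : {fset I}, \sum_(x <- F) `|g x| <= complex.Re B.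
  move=> gf F; have : (\sum_(x <- F) `|g x|)%:C <= B.
    rewrite rmorph_sum; apply: (le_trans _ (fB F)).
    by apply: ler_sum => x _; exact: gf.
  by rewrite lecE => /andP[].
have [|s hs] := @real_has_sum _ (fun x => complex.Re (f x)) (complex.Re B).
  by apply: bound => x; exact: normc_ge_Re.
have [|t ht] := @real_has_sum _ (fun x => complex.Im (f x)) (complex.Re B).
  by apply: bound => x; exact: normc_ge_Im.
exists (s%:C + 'i * t%:C).
have := has_sumD (has_sum_real_complex hs)
                 (has_sumZ 'i (has_sum_real_complex ht)).
by apply: eq_has_sum => x; rewrite !patch_setT /= -complexE.
Qed.

Lemma complex_has_sum_on {I : choiceType} (A D : set I) (f : I -> R[i]) B :
  A `<=` D ->
  (forall F : {fset I}, [set` F] `<=` D -> \sum_(x <- F) `|f x| <= B) ->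
  exists s, has_sum A f s.
Proof.
move=> AD fB.
(* [f] is extended by zero off [A]; its finite absolute subsums are then sums over finite subsets of
   [D], where the bound holds. *)
have [F|s hs] := @complex_has_sum _ (fun x => if x \in A then f x else 0) B; last first.
  by exists s; move: hs; apply: eq_has_sum => x; rewrite patch_setT !patchE.
apply: le_trans (fB [fset x in F | x \in A]%fset _); last first.
  by move=> x /=; rewrite !inE => /andP[_ /set_mem /AD].
rewrite big_fset /= [leRHS]big_mkcond ler_sum // => x _.
by case: ifP => //; rewrite normr0.
Qed.

End Existence.

(** * Factorisation of sequences at their peaks *)

Definition small (n : nat) : set (seq nat) :=
  [set x | all (fun i => 0 < i < n)%N x].

Definition small_sorted (r : rel nat) (n : nat) : set (seq nat) :=
  [set x | small n x /\ sorted r x].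

(** Twin of [right_part] with the peak value as a parameter, so that it applies to tails of a
    sequence for a fixed [n]. *)
Definition after (n : nat) (y : seq nat) : seq nat :=
  rev (take (index n (rev y)) (rev y)).

(* The part of a sequence with peak [n] starting at the first of its [k] peaks. *)
Definition peak_tail (r : rel nat) (n k : nat) : set (seq nat) :=
  [set y | [/\ head 0%N y = n, all (fun i => 0 < i <= n)%N y,
               count_mem n y = k & sorted r (after n y)]].

Lemma take_index_cat {T : eqType} {n : T} {x y : seq T} :
  n \notin x -> take (index n (x ++ n :: y)) (x ++ n :: y) = x.
Proof.
by move=> nx; rewrite index_cat (negbTE nx) /= eqxx addn0 take_size_cat.
Qed.

Lemma mem_split_index {T : eqType} {n : T} {s : seq T} :
  n \in s -> s = take (index n s) s ++ n :: drop (index n s).+1 s.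
Proof.
move=> ns; rewrite -{2}(nth_index n ns) -drop_nth ?index_mem //.
by rewrite cat_take_drop.
Qed.

Lemma notin_take_index {T : eqType} (n : T) (s : seq T) :
  n \notin take (index n s) s.
Proof.
elim: s => //= a s IH; case: eqP => [->|/eqP na] //=.
by rewrite inE negb_or eq_sym na IH.
Qed.

Lemma after_cat n x y : n \in y -> after n (x ++ y) = after n y.
Proof.
move=> ny; rewrite /after rev_cat index_cat mem_rev ny take_cat.
by rewrite index_mem mem_rev ny.
Qed.

Lemma after_cons n y : n \notin y -> after n (n :: y) = y.
Proof.
by move=> ny; rewrite /after rev_cons -cats1 take_index_cat ?mem_rev ?revK.
Qed.

Lemma small_notin n x : small n x -> n \notin x.
Proof. by move=> /allP h; apply/negP => /h; rewrite ltnn andbF. Qed.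

Lemma small_le {n x} :
  small n x <-> all (fun i => 0 < i <= n)%N x /\ n \notin x.
Proof.
split=> [nx|[/allP h nx]].
  split; last exact: small_notin.
  by apply: sub_all nx => i /andP[-> /ltnW].
apply/allP => i ix; have /andP[-> /=] := h _ ix.
by rewrite leq_eqVlt => /orP[/eqP iE|//]; rewrite -iE ix in nx.
Qed.

Lemma peak_tail1 (r : rel nat) n : (0 < n)%N ->
  peak_tail r n 1 = cons n @` small_sorted r n.
Proof.
move=> n0; apply/seteqP; split => [[|a y] [/= h0]|_ [y [sy ry] <-]].
- by rewrite h0 ltnn in n0.
- rewrite h0 eqxx => /andP[_ hy] [] /eqP; rewrite -leqn0 leqNgt -has_count.
  rewrite has_pred1 => ny; rewrite after_cons // => ry.
  by exists y => //; split => //; apply/small_le.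
- have [ay ny] := small_le.1 sy; split=> //=.
  + by rewrite n0 leqnn.
  + by rewrite eqxx (count_memPn ny).
  + by rewrite after_cons.
Qed.

(** Cut at the second peak. The last peak lies in the remaining tail, so the condition on what
    follows it carries over unchanged. *)
Lemma peak_tailS (r : rel nat) n k : (0 < n)%N ->
  peak_tail r n k.+2 =
  cons n @` [set x ++ y | x in small n & y in peak_tail r n k.+1].
Proof.
move=> n0; apply/seteqP; split => [[|a u] [/= h0]|_ [_ [x sx [y]]] [h0 ay cy ry] <- <-].
- by rewrite h0 ltnn in n0.
- rewrite h0 eqxx => /andP[_ hu] [cu] ru.
  have {}cu : count_mem n u = k.+1 := cu.
  have nu : n \in u by rewrite -has_pred1 has_count cu.
  have uE := mem_split_index nu; have := notin_take_index n u.
  move: uE; set x := take _ u; set y := _ :: _ => uE nx.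
  move: hu; rewrite uE all_cat => /andP[ax ay].
  exists (x ++ y) => //; exists x; first by apply/small_le.
  exists y => //; split => //.
    by move: cu; rewrite uE count_cat (count_memPn nx).
  by move: ru; rewrite -cat1s uE catA after_cat // mem_head.
- have ny : n \in y by rewrite -has_pred1 has_count cy.
  have [ax nx] := small_le.1 sx; split=> //=.
  + by rewrite n0 leqnn all_cat ax ay.
  + by rewrite eqxx count_cat (count_memPn nx) cy.
  + by rewrite -cat1s catA after_cat.
Qed.

Lemma peak_mem {mu} : mu != [::] -> peak mu \in mu.
Proof.
elim: mu => //= a [|b mu] IH _; first by rewrite /peak big_seq1 mem_head.
rewrite {1}/peak big_cons -/(peak (b :: mu)).
case: (leqP (peak (b :: mu)) a) => _; first exact: mem_head.
by rewrite inE IH // orbT.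
Qed.

Lemma peak_max {i mu} : i \in mu -> (i <= peak mu)%N.
Proof. by move=> im; rewrite /peak; apply: leq_bigmax_seq. Qed.

Lemma peak_eq n mu : n \in mu -> all (fun i => 0 < i <= n)%N mu -> peak mu = n.
Proof.
move=> nmu /allP h; apply/eqP; rewrite eqn_leq peak_max // andbT.
have /peak_mem/h/andP[] // : mu != [::] by apply: contraTneq nmu => ->.
Qed.

Lemma peak_rev mu : peak (rev mu) = peak mu.
Proof. by rewrite /peak; apply: perm_big; rewrite perm_rev. Qed.

Lemma right_partE mu : right_part mu = after (peak mu) mu.
Proof. by rewrite /right_part /left_part peak_rev. Qed.

(* Both sets of the theorem have this form, as [sorted ltn] implies
   [sorted leq] and [sorted gtn] implies [sorted geq]. *)
Definition multimodal_with (r : rel nat) : set (seq nat) :=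
  [set mu | [/\ mu != [::], all (fun i => 0 < i)%N mu,
                sorted ltn (left_part mu) & sorted r (right_part mu)]].

Lemma strongly_multimodalE : strongly_multimodal = multimodal_with gtn.
Proof.
apply/seteqP; split => mu.
  by case=> -[k k1 /and5P[? ? _ _ _]] ? ?; split.
case=> m0 mp ml mr; split=> //; exists (count_mem (peak mu) mu).
  by rewrite -has_count has_pred1 peak_mem.
apply/and5P; split=> //.
  by apply: sub_sorted ml; exact: ltnW.
by apply: sub_sorted mr => i j /ltnW.
Qed.

Lemma semistrongly_multimodalE : semistrongly_multimodal = multimodal_with geq.
Proof.
apply/seteqP; split => mu.
  by case=> -[k k1 /and5P[? ? _ _ ?]] ?; split.
case=> m0 mp ml mr; split=> //; exists (count_mem (peak mu) mu).
  by rewrite -has_count has_pred1 peak_mem.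
apply/and5P; split=> //.
by apply: sub_sorted ml; exact: ltnW.
Qed.

(** Cut at the first peak: the prefix is the left-hand partition, and everything else is a peak
    tail. *)
Lemma multimodal_with_peakE (r : rel nat) n k : (0 < n)%N ->
  [set mu | [/\ multimodal_with r mu, count_mem (peak mu) mu = k.+1 & peak mu = n]] =
  [set x ++ y | x in small_sorted ltn n & y in peak_tail r n k.+1].
Proof.
move=> n0; apply/seteqP; split => [mu [[m0 mp ml mr] mk mn]|].
  have nmu : n \in mu by rewrite -mn peak_mem.
  have amu : all (fun i => 0 < i <= n)%N mu.
    by apply/allP => i im; rewrite (allP mp) //= -mn peak_max.
  move: ml mr; rewrite right_partE /left_part mn.
  have nx := notin_take_index n mu; have muE := mem_split_index nmu.
  move: muE nx; set x := take _ mu; set y := _ :: _ => muE nx ml mr.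
  move: amu; rewrite muE all_cat => /andP[ax ay].
  exists x; first by split => //; apply/small_le.
  exists y => //; split => //.
    by move: mk; rewrite mn muE count_cat (count_memPn nx).
  by move: mr; rewrite muE after_cat // mem_head.
move=> _ [x [sx lx] [y [h0 ay cy ry] <-]].
have ny : n \in y by rewrite -has_pred1 has_count cy.
have [ax nx] := small_le.1 sx.
have axy : all (fun i => 0 < i <= n)%N (x ++ y) by rewrite all_cat ax ay.
have pE : peak (x ++ y) = n by apply: peak_eq => //; rewrite mem_cat ny orbT.
split=> //; last by rewrite pE count_cat (count_memPn nx) cy.
split.
- by apply: contraTneq ny; case: x {sx lx nx ax axy pE} => //= ->.
- by apply: sub_all axy => i /andP[].
- rewrite /left_part pE; case: y h0 {ny ay cy ry pE axy} => [|b y] /= h0.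
    by rewrite h0 ltnn in n0.
  by rewrite h0 take_index_cat.
- by rewrite right_partE pE after_cat.
Qed.

(** * Weights: multiplicativity and a uniform bound on finite sums *)

Lemma weight_cat {C : numFieldType} (z q : C) x y :
  weight z q (x ++ y) = weight z q x * weight z q y.
Proof. by rewrite /weight size_cat sumn_cat !exprD mulrACA. Qed.

Lemma weight_cons {C : numFieldType} (z q : C) i y :
  weight z q (i :: y) = z * q ^+ i * weight z q y.
Proof. by rewrite /weight /= exprS exprD mulrACA. Qed.

Lemma weight_nil {C : numFieldType} (z q : C) : weight z q [::] = 1.
Proof. by rewrite /weight !expr0 mulr1. Qed.

Lemma qpochS {C : numFieldType} (z q : C) n :
  qpoch (z * q) q n.+1 = (1 - z * q ^+ n.+1) * qpoch (z * q) q n.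
Proof. by rewrite /qpoch big_nat_recr //= mulrC exprS mulrA. Qed.

Section WeightBound.
Context {C : numFieldType}.
Implicit Types (z q a b : C).

Lemma sum_expr_le b K : 0 <= b -> b < 1 ->
  \sum_(i <- iota 1 K) b ^+ i <= b / (1 - b).
Proof.
move=> b0 b1; rewrite ler_pdivlMr ?subr_gt0 //.
suff -> : (\sum_(i <- iota 1 K) b ^+ i) * (1 - b) = b - b ^+ K.+1.
  by rewrite gerBl exprn_ge0.
elim: K => [|K IH]; first by rewrite big_nil mul0r expr1 subrr.
rewrite -[K.+1]addn1 iotaD big_cat /= big_seq1 mulrDl IH add1n addn1.
by rewrite mulrBr mulr1 -exprSr addrA subrK.
Qed.

(* The bound [B] solves [1 + r * B = B], where [r = a * b / (1 - b)] bounds the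
   total weight of the one-element sequences. *)
Lemma weight_sum_le a b : 0 <= a -> 0 <= b -> b < 1 / (1 + a) ->
  exists B, forall F : {fset seq nat},
    [set` F] `<=` [set mu | all (fun i => 0 < i)%N mu] ->
    \sum_(mu <- F) weight a b mu <= B.
Proof.
move=> a0 b0; have a1 : 0 < 1 + a by rewrite ltr_wpDr.
(* Cleared of its denominator, the hypothesis reads [b + b * a < 1]; this makes the denominator of
   [B] positive. *)
rewrite ltr_pdivlMr // mulrDr mulr1 => hab.
have b1 : b < 1 by apply: le_lt_trans hab; rewrite lerDl mulr_ge0.
have w0 mu : 0 <= weight a b mu by rewrite mulr_ge0 ?exprn_ge0.
have d0 : 0 < 1 - b - b * a by rewrite -addrA -opprD subr_gt0.
pose B := (1 - b) / (1 - b - b * a).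
have B0 : 0 <= B by rewrite divr_ge0 ?ltW // subr_gt0.
have hB : 1 + a * (b / (1 - b)) * B = B.
  rewrite /B; field; rewrite !gt_eqF // ?subr_gt0 //.
(* Explicit lists covering all sequences of length at most [N] with entries from 1 to [K], built by
   prepending a first entry. The bound [B] is the same for all [N] and [K]. *)
have key N K : exists2 L : seq (seq nat),
    forall s, (size s <= N)%N -> all (fun i => 0 < i <= K)%N s -> s \in L
  & \sum_(mu <- L) weight a b mu <= B.
  elim: N => [|N [L hL LB]].
    exists [:: [::]]; first by case.
    rewrite big_seq1 weight_nil -hB lerDl mulr_ge0 // mulr_ge0 // divr_ge0 //.
    by rewrite ltW ?subr_gt0.
  exists ([::] :: [seq i :: s | i <- iota 1 K, s <- L]).
    case=> [|i s] //= sN /andP[iK sK]; rewrite inE; apply/orP; right.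
    by apply: allpairs_f; [rewrite mem_iota add1n ltnS|exact: hL].
  rewrite big_cons weight_nil big_allpairs_dep -hB lerD2l.
  apply: (@le_trans _ _ (\sum_(i <- iota 1 K) a * b ^+ i * B)).
    apply: ler_sum => i _; under eq_bigr do rewrite weight_cons.
    by rewrite -mulr_sumr ler_wpM2l // mulr_ge0 ?exprn_ge0.
  by rewrite -mulr_suml -mulr_sumr ler_wpM2r // ler_wpM2l // sum_expr_le.
exists B => F hF.
(* Lengths and entries are bounded on the finite set [F], so a single list covers it. *)
have [L hL] := key (\max_(mu <- F) size mu)%N (\max_(mu <- F) peak mu)%N.
apply: le_trans; apply: ler_sum_uniq_sub => // mu muF; apply: hL.
  exact: leq_bigmax_seq.
apply/allP => i imu; rewrite (allP (hF mu muF)) //=.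
by apply: leq_trans (peak_max imu) _; apply: leq_bigmax_seq.
Qed.

End WeightBound.

(** * Generating functions of the factors and of the full sets *)

Section GeneratingFunctions.
Context {R : realType} {z q : R[i]}.
Hypothesis hq : `|q| < 1 / (1 + `|z|).
Local Notation w := (weight z q).
Implicit Types (X Y : set (seq nat)) (r : rel nat).
Local Notation pos := [set mu : seq nat | all (fun i => 0 < i)%N mu].

(** Supplies sums before their values are known, so that the functional equations below can be
    solved for them. *)
Lemma pos_has_sum {X} : X `<=` pos -> exists s, has_sum X w s.
Proof.
have [B hB] := weight_sum_le _ _ (normr_ge0 z) (normr_ge0 q) hq.
move=> Xpos; apply: (@complex_has_sum_on _ _ X _ w B Xpos) => F /hB; apply: le_trans.
by apply: ler_sum => mu _; rewrite /weight normrM !normrX.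
Qed.

Lemma small_pos n : small n `<=` pos.
Proof. by move=> x; apply: sub_all => i /andP[]. Qed.

Lemma has_sum_cons i {X s} :
  has_sum X w s -> has_sum (cons i @` X) w (z * q ^+ i * s).
Proof.
move=> hs; apply: has_sum_image => [x y _ _ []//|].
move: (has_sumZ (z * q ^+ i) hs); apply: eq_has_sum => x.
by rewrite !patchE /= weight_cons.
Qed.

(** Since [x] avoids [n] and [y] starts with [n], cutting [x ++ y] at its first [n] recovers both
    factors. Grouping by the prefix [x] turns the sum into the product. *)
Lemma has_sum_cat n {X Y s t} : X `<=` small n ->
    Y `<=` [set y | pos y /\ exists y', y = n :: y'] ->
  has_sum X w s -> has_sum Y w t ->
  has_sum [set x ++ y | x in X & y in Y] w (s * t).
Proof.
move=> Xn Yn hs ht; set XY := (X in has_sum X).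
have XYpos : XY `<=` pos.
  move=> _ [x /Xn/small_pos xpos [y /Yn[ypos _] <-]] /=.
  by rewrite all_cat xpos.
have takeE x y : X x -> Y y -> take (index n (x ++ y)) (x ++ y) = x.
  by move=> /Xn/small_notin nx /Yn[_ [y' ->]]; rewrite take_index_cat.
have [u hu] := pos_has_sum XYpos.
suff hXu : has_sum setT (fun x => if x \in X then t * w x else 0) u.
  suff <- : u = s * t by [].
  apply: has_sum_unique hXu _; rewrite mulrC.
  by move: (has_sumZ t hs); apply: eq_has_sum => x; rewrite patch_setT patchE.
apply: (@has_sum_fibres _ _ _ XY (fun mu => take (index n mu) mu) w) hu _ => x.
case: ifPn => [/set_mem Xx|xX]; last first.
  move: (has_sum_set0 w); apply: eq_has_sum => mu; congr patch.
  apply/seteqP; split => // _ [[x' Xx' [y Yy] <-]] /=.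
  by rewrite takeE // => xx'; case/negP: xX; rewrite -xx' mem_set.
have -> : XY `&` (fun mu => take (index n mu) mu) @^-1` [set x] = cat x @` Y.
  apply/seteqP; split => [_ [[x' Xx' [y Yy] <-]] /=|_ [y Yy <-]].
    by rewrite takeE // => ->; exists y.
  by split; [exists x => //; exists y|rewrite /= takeE].
apply: has_sum_image => [y y' _ _ /eqP|].
  by rewrite eqseq_cat // eqxx => /eqP.
move: (has_sumZ (w x) ht); rewrite mulrC; apply: eq_has_sum => y.
by rewrite !patchE /= weight_cat.
Qed.

(** Splitting by first entry gives [s = 1 + z (q + ... + q^n) s]. Entries below [n.+1] run from 1 to
    [n], whence the index [n] of [qbrace]. *)
Lemma has_sum_small n : has_sum (small n.+1) w (qbrace (z * q) q n)^-1.
Proof.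
have [s hs] := pos_has_sum (@small_pos n.+1).
suff sE : s * qbrace (z * q) q n = 1.
  (* The product [sE] also shows that the brace does not vanish, so its inverse is a true one and
     not the default 0. *)
  have q0 : qbrace (z * q) q n != 0.
    by apply: contra_eq_neq sE => ->; rewrite mulr0 eq_sym oner_neq0.
  by rewrite -[_^-1]mul1r -sE mulfK.
pose H m := [set x | small n.+1 x /\
                     exists2 i, (0 < i <= m)%N & exists y, x = i :: y].
have hH m : (m <= n)%N ->
    has_sum (H m) w (z * q * (\sum_(0 <= i < m) q ^+ i) * s).
  elim: m => [|m IH] mn.
    rewrite big_nil mulr0 mul0r; move: (has_sum_set0 w); apply: eq_has_sum => x.
    by congr patch; apply/seteqP; split => // y [_ [[]]].
  have -> : H m.+1 = H m `|` (cons m.+1 @` small n.+1).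
    apply/seteqP; split => [x [sx [i /andP[i0 im] [y xE]]]|x [[sx [i im hy]]|[y sy <-]]].
    - have := im; rewrite leq_eqVlt => /orP[/eqP iE|im'].
        by right; exists y; move: sx; rewrite xE iE // => /andP[].
      by left; split => //; exists i; [rewrite i0 -ltnS|exists y].
    - by split => //; exists i => //; case/andP: im => -> /leqW.
    - by split; [apply/andP|exists m.+1; [rewrite ltnS leqnn|exists y]].
  have expand u : z * q * (u + q ^+ m) * s = z * q * u * s + z * q ^+ m.+1 * s.
    by rewrite exprS; ring.
  rewrite (big_nat_recr _ _ _ (leq0n m)) expand.
  apply: has_sumU; [|exact: IH (ltnW mn)|exact: has_sum_cons].
  move=> x [[_ [i im [y ->]]] [y' _ [iE _]]].
  by rewrite -iE ltnn andbF in im.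
have sH : small n.+1 = [set [::]] `|` H n.
  apply/seteqP; split => [[|i x] sx|x [->|[]]] //; [by left|right].
  by split => //; exists i; [case/andP: sx|exists x].
have : has_sum (small n.+1) w (1 + z * q * (\sum_(0 <= i < n) q ^+ i) * s).
  rewrite {1}sH -(weight_nil z q); apply: has_sumU; last exact: hH.
    by move=> x [-> [_ [i _ [y]]]].
  exact: has_sum_set1.
move/(has_sum_unique hs) => sE; rewrite /qbrace mulrBr mulr1 {1}sE.
by rewrite [s * _]mulrC addrK.
Qed.

Lemma small_sorted_pos r n : small_sorted r n `<=` pos.
Proof. by move=> x [/small_pos]. Qed.

Lemma small_sorted1 r : small_sorted r 1 = [set [::]].
Proof.
apply/seteqP; split => [[|i x] [] // /andP[]|x -> //].
by rewrite ltnS; case: i.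
Qed.

(** The value [n.+1] can occur only once, at the front. Its absence or presence gives the new factor
    [1 + z q^(n+1)]. *)
Lemma has_sum_decr n :
  has_sum (small_sorted gtn n.+1) w (qpoch (- z * q) q n).
Proof.
elim: n => [|n IH].
  rewrite small_sorted1 /qpoch big_nil -(weight_nil z q); exact: has_sum_set1.
have -> : small_sorted gtn n.+2 =
    small_sorted gtn n.+1 `|` (cons n.+1 @` small_sorted gtn n.+1).
  apply/seteqP; split => [[|i x] []|x [[sx gx]|[y [sy gy] <-]]].
  - by left.
  - move=> /andP[/andP[i0 iN] sx] /= gx.
    move: (gx); rewrite path_sortedE; last by move=> ? ? ? /= /[swap]; exact: ltn_trans.
    case/andP => lx gx'; have [ni|ni] := ltnP i n.+1.
      left; split => //; apply/andP; split; first by rewrite i0.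
      apply/allP => j jx; have := allP sx _ jx; have /= := allP lx _ jx.
      by move=> ji /andP[-> _]; exact: ltn_trans ji ni.
    have -> : i = n.+1 by apply/eqP; rewrite eqn_leq ni andbT -ltnS.
    right; exists x => //; split => //; apply/allP => j jx.
    have := allP sx _ jx; have /= := allP lx _ jx.
    by move=> ji /andP[-> _] /=; apply: leq_trans ji _; rewrite -ltnS.
  - by split => //; apply: sub_all sx => i /andP[-> /leqW].
  - split.
      apply/andP; split; first by apply/andP.
      by apply: sub_all sy => i /andP[-> /leqW].
    rewrite /= path_sortedE; last by move=> ? ? ? /= /[swap]; exact: ltn_trans.
    by rewrite gy andbT; apply: sub_all sy => i /andP[].
rewrite qpochS mulNr opprK mulrDl mul1r.
apply: has_sumU; [|exact: IH|exact: has_sum_cons].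
by move=> x [[/small_notin nx _] [y _ xE]]; rewrite -xE mem_head in nx.
Qed.

Lemma has_sum_incr n :
  has_sum (small_sorted ltn n.+1) w (qpoch (- z * q) q n).
Proof.
have -> : small_sorted ltn n.+1 = rev @` small_sorted gtn n.+1.
  apply/seteqP; split => [x [sx gx]|_ [x [sx gx] <-]].
    exists (rev x); last exact: revK.
    by split; [rewrite /small /= all_rev|rewrite rev_sorted].
  by split; [rewrite /small /= all_rev|rewrite rev_sorted].
apply: has_sum_image => [x y _ _|]; first exact: (can_inj revK).
move: (has_sum_decr n); apply: eq_has_sum => x.
by rewrite !patchE /= /weight size_rev sumn_rev.
Qed.

(** Either [n.+1] does not occur, or removing it from the front leaves a sequence of the same kind.
    Hence [t = s + z q^(n+1) t]. *)
Lemma has_sum_weakly_decr n :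
  has_sum (small_sorted geq n.+1) w (qpoch (z * q) q n)^-1.
Proof.
(* The induction carries a product equal to 1, which yields nonvanishing along with the value. *)
suff [s hs sE] : exists2 s, has_sum (small_sorted geq n.+1) w s
    & s * qpoch (z * q) q n = 1.
  have q0 : qpoch (z * q) q n != 0.
    by apply: contra_eq_neq sE => ->; rewrite mulr0 eq_sym oner_neq0.
  by rewrite -[_^-1]mul1r -sE mulfK.
elim: n => [|n [s hs sE]].
  exists 1; last by rewrite /qpoch big_nil mulr1.
  rewrite small_sorted1 -(weight_nil z q); exact: has_sum_set1.
have [t ht] := pos_has_sum (@small_sorted_pos geq n.+2).
exists t => //.
have E : small_sorted geq n.+2 =
    small_sorted geq n.+1 `|` (cons n.+1 @` small_sorted geq n.+2).
  apply/seteqP; split => [[|i x] []|x [[sx gx]|[y [sy gy] <-]]].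
  - by left.
  - move=> /andP[/andP[i0 iN] sx] /= gx.
    move: (gx); rewrite path_sortedE; last by move=> ? ? ? /= /[swap]; exact: leq_trans.
    case/andP => lx gx'; have [ni|ni] := ltnP i n.+1.
      left; split => //; apply/andP; split; first by rewrite i0.
      apply/allP => j jx; have := allP sx _ jx; have /= := allP lx _ jx.
      by move=> ji /andP[-> _]; exact: leq_ltn_trans ji ni.
    have -> : i = n.+1 by apply/eqP; rewrite eqn_leq ni andbT -ltnS.
    by right; exists x.
  - by split => //; apply: sub_all sx => i /andP[-> /leqW].
  - split; first by apply/andP; split => //; apply/andP.
    rewrite /= path_sortedE; last by move=> ? ? ? /= /[swap]; exact: leq_trans.
    by rewrite gy andbT; apply: sub_all sy => i /andP[].
have : has_sum (small_sorted geq n.+2) w (s + z * q ^+ n.+1 * t).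
  rewrite {1}E; apply: has_sumU; [|exact: hs|exact: has_sum_cons].
  by move=> x [[/small_notin nx _] [y _ xE]]; rewrite -xE mem_head in nx.
move/(has_sum_unique ht) => tE.
by rewrite qpochS mulrA mulrBr mulr1 {1}tE [t * _]mulrC addrK.
Qed.

Lemma has_sum_peak_tail {r n} k {d} : has_sum (small_sorted r n.+1) w d ->
  has_sum (peak_tail r n.+1 k.+1) w
    (z * q ^+ n.+1 * ((qbrace (z * q) q n)^-1 * (z * q ^+ n.+1)) ^+ k * d).
Proof.
move=> hd; elim: k => [|k IH].
  by rewrite expr0 mulr1 (peak_tail1 _ _ (ltn0Sn n)); exact: has_sum_cons.
rewrite (peak_tailS _ _ _ (ltn0Sn n)).
(* [u] is the weight of one peak and [v] the sum over the arbitrary blocks between consecutive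
   peaks. *)
set u := z * q ^+ n.+1 in IH *; set v := _^-1 in IH *.
have -> : u * (v * u) ^+ k.+1 * d = u * (v * (u * (v * u) ^+ k * d)).
  by rewrite (exprS _ k) !mulrA.
apply: has_sum_cons; apply: (@has_sum_cat n.+1).
- by [].
- move=> [|i y] [/= hi ay _ _] //; split; last by exists y; rewrite hi.
  by apply: sub_all (ay : all _ (i :: y)) => j /andP[].
- exact: has_sum_small.
- exact: IH.
Qed.

Lemma has_sum_multimodal_peak {r n} k {d} : has_sum (small_sorted r n.+1) w d ->
  has_sum [set mu | [/\ multimodal_with r mu, count_mem (peak mu) mu = k.+1
                       & peak mu = n.+1]] w
    (qpoch (- z * q) q n *
     (z * q ^+ n.+1 * ((qbrace (z * q) q n)^-1 * (z * q ^+ n.+1)) ^+ k * d)).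
Proof.
move=> hd; rewrite (multimodal_with_peakE _ _ _ (ltn0Sn n)); apply: (@has_sum_cat n.+1).
- by move=> x [].
- move=> [|i y] [/= hi ay _ _] //; split; last by exists y; rewrite hi.
  by apply: sub_all (ay : all _ (i :: y)) => j /andP[].
- exact: has_sum_incr.
- exact: has_sum_peak_tail.
Qed.

(** Two groupings of one unconditional sum: first by the number of peaks, then by the peak value. *)
Lemma multimodal_generating {r} {d : nat -> R[i]} (a : nat -> nat -> R[i]) :
    (forall n, has_sum (small_sorted r n.+1) w (d n)) ->
    (forall k n, a k.+1 n.+1 = qpoch (- z * q) q n * (z * q ^+ n.+1 *
       ((qbrace (z * q) q n)^-1 * (z * q ^+ n.+1)) ^+ k * d n)) ->
  has_sum (multimodal_with r) w (genfun (multimodal_with r) z q) /\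
  has_iterated_sum a (genfun (multimodal_with r) z q).
Proof.
move=> hd ha.
have mpos : multimodal_with r `<=` pos by move=> mu [].
have [s hs] := pos_has_sum mpos.
(* [genfun] is defined as a limit, so its value is identified only once convergence is known. *)
have -> : genfun (multimodal_with r) z q = s.
  by apply: (cvg_lim _ hs); exact: norm_hausdorff.
split; first exact: hs.
pose A k := multimodal_with r `&` (fun mu => count_mem (peak mu) mu) @^-1` [set k].
have Apos k : A k `<=` pos by move=> mu [/mpos].
pose b k := sval (cid (pos_has_sum (Apos k))).
have hb k : has_sum (A k) w (b k) := svalP (cid (pos_has_sum (Apos k))).
(* Fibres are indexed by all of [nat], whereas the series start at 1; the term at 0 must vanish. *)
have drop0 (f : nat -> R[i]) t : f 0%N = 0 -> has_sum setT f t ->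
    (\sum_(1 <= n < N) f n) @[N --> \oo] --> t.
  move=> f0 /has_sum_nat; apply: cvg_trans; apply: near_eq_cvg.
  near=> N; rewrite [LHS]big_ltn ?f0 ?add0r //; near: N; exact: nbhs_infty_gt.
exists b => [[|k] k1|]; [discriminate k1| |].
  (* [a] is unconstrained at [n = 0], so that value is replaced by 0, the sum over the empty fibre
     of peak 0. *)
  pose c n := if n is m.+1 then a k.+1 m.+1 else 0.
  have : has_sum setT c (b k.+1).
    apply: (@has_sum_fibres _ _ _ _ peak w) (hb k.+1) _ => -[|n] /=.
      move: (has_sum_set0 w); apply: eq_has_sum => mu; congr patch.
      apply/seteqP; split => // {}mu [[[m0 mp _ _] _]] /= p0.
      by have := allP mp _ (peak_mem m0); rewrite p0.
    rewrite ha; move: (has_sum_multimodal_peak k (hd n)); apply: eq_has_sum => mu.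
    by congr patch; apply/seteqP; split => {}mu [] // [].
  move/drop0 => /(_ erefl); apply: cvg_trans; apply: near_eq_cvg.
  by near=> N; apply: eq_big_nat => -[|n].
apply: drop0; last first.
  exact: (@has_sum_fibres _ _ _ _ (fun mu => count_mem (peak mu) mu) w _ b hs hb).
(* [b 0] vanishes because a nonempty sequence contains its peak at least once. *)
apply: has_sum_unique (hb 0%N) _; move: (has_sum_set0 w); apply: eq_has_sum => mu.
congr patch; apply/seteqP; split => // {}mu [[m0 _ _ _]] /= /eqP.
by rewrite -leqn0 leqNgt -has_count has_pred1 peak_mem.
Unshelve. all: by end_near.
Qed.

End GeneratingFunctions.

Theorem theorem5 (R : realType) (z q : R[i])
    (hq : `|q| < 1 / (1 + `|z|)) :
  (has_sum strongly_multimodal (weight z q) (genfun strongly_multimodal z q) /\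
   has_iterated_sum
     (fun k n => z ^+ k * q ^+ (k * n) * qpoch (- z * q) q n.-1 ^+ 2
                 / qbrace (z * q) q n.-1 ^+ k.-1)
     (genfun strongly_multimodal z q)) /\
  (has_sum semistrongly_multimodal (weight z q)
     (genfun semistrongly_multimodal z q) /\
   has_iterated_sum
     (fun k n => z ^+ k * q ^+ (k * n) * qpoch (- z * q) q n.-1
                 / (qbrace (z * q) q n.-1 ^+ k.-1 * qpoch (z * q) q n.-1))
     (genfun semistrongly_multimodal z q)).
Proof.
have powE k n : z ^+ k * q ^+ (k * n) = (z * q ^+ n) ^+ k.
  by rewrite mulnC exprM -exprMn.
rewrite strongly_multimodalE semistrongly_multimodalE; split.
  (* Both outer parts are strict here and contribute the same q-product, hence the square. *)
  apply: (multimodal_generating hq _ has_sum_decr) => k n /=.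
  rewrite powE; move: (z * q ^+ n.+1) => u; rewrite exprS exprMn exprVn expr2.
  by ring.
apply: (multimodal_generating hq _ (has_sum_weakly_decr hq)) => k n /=.
rewrite powE; move: (z * q ^+ n.+1) => u; rewrite exprS exprMn exprVn invfM.
by ring.
Qed.
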